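(* Let $G_1,G_2,G_3$ be graphs on a common vertex set $V$ with $|V|=n$, with no rainbow triangle, and such that every pair of distinct vertices of $V$ is an edge of at least one of $G_1,G_2,G_3$. If $n$ is sufficiently large, then the maximum of $e(G_1)e(G_2)e(G_3)$ over all such triples is attained by a triple of the following form: for some partition $V=X\cup Y$, $G_1$ is the complete graph on $X$ (with no other edges), $G_2$ is the disjoint union of the complete graph on $X$ and the complete graph on $Y$, and $G_3$ consists of the complete graph on $Y$ together with all edges between $X$ and $Y$.
   Context: All graphs are simple. For a graph $G$, $e(G)=|E(G)|$ is its number of edges. Given graphs $G_1,G_2,G_3$ on a common vertex set, a rainbow triangle is a set of three distinct vertices $u,v,w$ such that the three edges $uv, vw, uw$ can be assigned to $G_1,G_2,G_3$ bijectively, each edge lying in the edge set of the graph it is assigned to (i.e., the triangle consists of one edge from each $G_i$). *)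

(* Defs.v *)
From mathcomp Require Import all_boot all_fingroup.

Set Implicit Arguments.
Unset Strict Implicit.
Unset Printing Implicit Defensive.

Record sgraph (V : finType) := SGraph {
  adj :> rel V;
  adj_sym : symmetric adj;
  adj_irr : irreflexive adj
}.

Definition edges (V : finType) (G : sgraph V) : {set {set V}} :=
  [set [set x; y] | x in V, y in V & adj G x y].

(* The permutation [s] is the bijective assignment of the three sides of the
   triangle to the three graphs. *)
Definition rainbow_triangle (V : finType) (G1 G2 G3 : sgraph V) (u v w : V) :=
  [/\ u != v, v != w, u != w &
   exists s : 'S_3, forall i : 'I_3,
     tnth [tuple [set u; v]; [set v; w]; [set u; w]] i
       \in edges (tnth [tuple G1; G2; G3] (s i))].

Definition admissible (V : finType) (G1 G2 G3 : sgraph V) :=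
  (forall u v w : V, ~ rainbow_triangle G1 G2 G3 u v w) /\
  (forall u v : V, u != v ->
     [\/ [set u; v] \in edges G1, [set u; v] \in edges G2
       | [set u; v] \in edges G3]).

Definition edge_product (V : finType) (G1 G2 G3 : sgraph V) : nat :=
  #|edges G1| * #|edges G2| * #|edges G3|.

Definition complete_edges (V : finType) (X : {set V}) : {set {set V}} :=
  [set e : {set V} | (e \subset X) && (#|e| == 2)].

Definition cross_edges (V : finType) (X Y : {set V}) : {set {set V}} :=
  [set [set x; y] | x in X, y in Y].

(* [finset.partition [set X; Y] setT] is avoided: it would allow X = Y = setT. *)
Definition extremal_form (V : finType) (X Y : {set V}) (G1 G2 G3 : sgraph V) :=
  [/\ (X :|: Y = [set: V]) /\ [disjoint X & Y],
      edges G1 = complete_edges X,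
      edges G2 = complete_edges X :|: complete_edges Y
    & edges G3 = complete_edges Y :|: cross_edges X Y].

(* Main.v *)
Require Import Defs.
From mathcomp Require Import all_boot all_fingroup zify.

Set Implicit Arguments.
Unset Strict Implicit.
Unset Printing Implicit Defensive.

(** Give each pair of vertices the set of the graphs containing it.  If [uv] has
    two colours and [uw] the third one, then [uw] and [vw] both carry only that
    third colour.  Hence in a connected component of the pairs with at least two
    colours, of size at least three, all these pairs carry the same two colours,
    the third colour is absent, and every pair leaving the component has one
    colour only.

    If no component has more than [5n/7] vertices, then [e1 + e2 + e3] is so small
    that the AM-GM inequality gives less than the construction with
    [|X| = 4 floor(n/5)].  Otherwise let [X] be the big component, with colours 1
    and 2.  Inside [X] the third colour is absent, so [e3] is the smallest factor
    and recolouring pairs outside [X] with colour 3 increases the product; this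
    leads to the construction with part [X], unless at most three vertices lie
    outside [X], when [e3] is linear in [n]. *)

(** * Rainbow-free triples and pairs with several colours *)

(** One orientation in [rf_free] covers all six colour assignments, since [u], [v], [w] are
    arbitrary and the relations symmetric; irreflexivity makes the three vertices distinct. *)
Record rainbow_free (V : finType) (g1 g2 g3 : rel V) : Prop := RainbowFree {
  rf_sym1 : symmetric g1; rf_sym2 : symmetric g2; rf_sym3 : symmetric g3;
  rf_irr1 : irreflexive g1; rf_irr2 : irreflexive g2; rf_irr3 : irreflexive g3;
  rf_cover : forall u v, u != v -> [|| g1 u v, g2 u v | g3 u v];
  rf_free : forall u v w, g1 u v -> g2 v w -> g3 u w -> False }.

Lemma rainbow_free_swap (V : finType) (g1 g2 g3 : rel V) :
  rainbow_free g1 g2 g3 -> rainbow_free g2 g1 g3.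
Proof.
case=> s1 s2 s3 i1 i2 i3 cov fr; split=> //.
  by move=> u v /cov; rewrite orbCA.
by move=> u v w h1 h2 h3; apply: (fr w v u); rewrite ?(s1 w) ?(s2 v) ?(s3 w).
Qed.

Lemma rainbow_free_rot (V : finType) (g1 g2 g3 : rel V) :
  rainbow_free g1 g2 g3 -> rainbow_free g2 g3 g1.
Proof.
case=> s1 s2 s3 i1 i2 i3 cov fr; split=> //.
  by move=> u v /cov; rewrite orbC -orbA.
by move=> u v w h1 h2 h3; apply: (fr w u v); rewrite ?(s1 w) ?(s3 w).
Qed.

(** With [uv] in colour 1 or 2 at choice and [uw] in colour 3, colour 1 or 2 on [vw] completes a
    rainbow triangle. So [vw] has colour 3, and the same argument then forbids colours 1 and 2 on
    [uw]. *)
Lemma rainbow_free_star (V : finType) (g1 g2 g3 : rel V) u v w :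
  rainbow_free g1 g2 g3 -> g1 u v -> g2 u v -> g3 u w -> v != w ->
  [/\ g3 v w, ~~ g1 v w, ~~ g2 v w, ~~ g1 u w & ~~ g2 u w].
Proof.
case=> s1 s2 s3 i1 i2 i3 cov fr h1 h2 h3 nvw.
have n2 : ~~ g2 v w by apply/negP => h; exact: (fr u v w).
have n1 : ~~ g1 v w.
  by apply/negP => h; apply: (fr w v u); rewrite ?(s1 w) ?(s2 v) ?(s3 w).
have g3vw : g3 v w by move: (cov _ _ nvw); rewrite (negbTE n1) (negbTE n2).
split=> //; apply/negP => h.
  by apply: (fr w u v); rewrite ?(s1 w) ?(s3 w).
by apply: (fr v u w); rewrite ?(s1 v).
Qed.

Definition colours (V : finType) (g1 g2 g3 : rel V) (u v : V) : nat :=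
  g1 u v + g2 u v + g3 u v.

Definition multi (V : finType) (g1 g2 g3 : rel V) : rel V :=
  fun u v => 1 < colours g1 g2 g3 u v.

Definition exactly2 (V : finType) (g1 g2 g3 : rel V) : rel V :=
  fun u v => [&& g1 u v, g2 u v & ~~ g3 u v].

Definition all3 (V : finType) (g1 g2 g3 : rel V) : rel V :=
  fun u v => [&& g1 u v, g2 u v & g3 u v].

Lemma multi_rot (V : finType) (g1 g2 g3 : rel V) u v :
  multi g2 g3 g1 u v = multi g1 g2 g3 u v.
Proof. by rewrite /multi /colours; congr (_ < _); lia. Qed.

Lemma multi_sym (V : finType) (g1 g2 g3 : rel V) :
  rainbow_free g1 g2 g3 -> symmetric (multi g1 g2 g3).
Proof.
case=> s1 s2 s3 *; rewrite /multi /colours => u v.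
by rewrite (s1 u) (s2 u) (s3 u).
Qed.

Lemma multi_cases (V : finType) (g1 g2 g3 : rel V) u v : multi g1 g2 g3 u v ->
  [\/ exactly2 g1 g2 g3 u v, exactly2 g2 g3 g1 u v, exactly2 g3 g1 g2 u v
    | all3 g1 g2 g3 u v].
Proof.
rewrite /multi /colours /exactly2 /all3.
by case: (g1 u v) (g2 u v) (g3 u v) => [] [] [] //= _; 
  [constructor 4|constructor 1|constructor 3|constructor 2].
Qed.

(** Colour 3 on [uw] would be its only colour by [rainbow_free_star]; without it, two colours on
    [uw] can only be 1 and 2. *)
Lemma multi_exactly2 (V : finType) (g1 g2 g3 : rel V) u v w :
  rainbow_free g1 g2 g3 -> exactly2 g1 g2 g3 u v -> multi g1 g2 g3 u w ->
  exactly2 g1 g2 g3 u w.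
Proof.
move=> rf /and3P[h1 h2 h3] mu.
have [<-|nvw] := eqVneq v w; first by apply/and3P.
have n3 : ~~ g3 u w.
  apply/negP => h.
  have [_ _ _ n1 n2] := rainbow_free_star rf h1 h2 h nvw.
  by move: mu; rewrite /multi /colours (negbTE n1) (negbTE n2) h.
move: mu; rewrite /multi /colours /exactly2 (negbTE n3).
by case: (g1 u w) (g2 u w) => [] [].
Qed.

(** Any colour of [uw] is complementary to two colours of [uv], so [rainbow_free_star] leaves [uw]
    no other colour. Three-coloured pairs thus form a matching and are components of their own. *)
Lemma multi_all3 (V : finType) (g1 g2 g3 : rel V) u v w :
  rainbow_free g1 g2 g3 -> all3 g1 g2 g3 u v -> multi g1 g2 g3 u w -> w = v.
Proof.
move=> rf /and3P[h1 h2 h3] mu; apply/eqP; rewrite eq_sym.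
apply/negP => /negP nvw.
have nuw : u != w.
  apply: contraTneq mu => <-.
  by rewrite /multi /colours (rf_irr1 rf) (rf_irr2 rf) (rf_irr3 rf).
have rf' := rainbow_free_rot rf; have rf'' := rainbow_free_rot rf'.
have := rf_cover rf nuw; case/or3P => h.
- have [_ _ _ n1 n2] := rainbow_free_star rf' h2 h3 h nvw.
  by move: mu; rewrite /multi /colours (negbTE n1) (negbTE n2) h.
- have [_ _ _ n1 n2] := rainbow_free_star rf'' h3 h1 h nvw.
  by move: mu; rewrite /multi /colours (negbTE n1) (negbTE n2) h.
- have [_ _ _ n1 n2] := rainbow_free_star rf h1 h2 h nvw.
  by move: mu; rewrite /multi /colours (negbTE n1) (negbTE n2) h.
Qed.

(** * Components of the pairs with several colours *)

Definition component (V : finType) (g1 g2 g3 : rel V) (x : V) : {set V} :=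
  [set y | connect (multi g1 g2 g3) x y].

Lemma connect_invariant (V : finType) (e : rel V) (P : V -> Prop) x y :
  P x -> (forall u v, P u -> e u v -> P v) -> connect e x y -> P y.
Proof.
move=> Px step /connectP[p ep ->]; elim: p x Px ep => //= z p IH x Px /andP[exz].
exact/IH/(step x).
Qed.

Lemma multi_type (V : finType) (g1 g2 g3 : rel V) x v y z :
  rainbow_free g1 g2 g3 -> exactly2 g1 g2 g3 x v ->
  y \in component g1 g2 g3 x -> multi g1 g2 g3 y z -> exactly2 g1 g2 g3 y z.
Proof.
move=> rf xv; rewrite inE => xy.
have [t] : exists t, exactly2 g1 g2 g3 y t.
  apply: (connect_invariant (P := fun a => exists t, exactly2 g1 g2 g3 a t) _ _ xy).
    by exists v.
  move=> u w [t ut] /(multi_exactly2 rf ut) /and3P[h1 h2 h3]; exists u.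
  by rewrite /exactly2 (rf_sym1 rf) (rf_sym2 rf) (rf_sym3 rf) h1 h2.
exact: multi_exactly2.
Qed.

Lemma connect_multi_sym (V : finType) (g1 g2 g3 : rel V) :
  rainbow_free g1 g2 g3 -> connect_sym (multi g1 g2 g3).
Proof. by move=> rf; apply: sym_connect_sym; apply: multi_sym. Qed.

Lemma component_single (V : finType) (g1 g2 g3 : rel V) x u w :
  u \in component g1 g2 g3 x -> w \notin component g1 g2 g3 x ->
  colours g1 g2 g3 u w <= 1.
Proof.
rewrite !inE => xu; rewrite leqNgt; apply: contra => muw.
exact/(connect_trans xu)/connect1.
Qed.

(** Colour 3 from a vertex [a] to [w] is passed on along each pair [ab] of colours 1 and 2.
    Following a path from [u] to [w], it would end as a loop at [w]. *)
Lemma component_third (V : finType) (g1 g2 g3 : rel V) x v :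
  rainbow_free g1 g2 g3 -> exactly2 g1 g2 g3 x v ->
  {in component g1 g2 g3 x &, forall u w, ~~ g3 u w}.
Proof.
move=> rf xv u w uC wC; apply/negP => uw.
have muw : connect (multi g1 g2 g3) u w.
  move: uC wC; rewrite !inE => xu; apply: connect_trans.
  by rewrite connect_multi_sym.
suff [_] : w \in component g1 g2 g3 x /\ g3 w w by rewrite (rf_irr3 rf).
apply: (connect_invariant (P := fun a => a \in _ /\ g3 a w) _ _ muw) => // a b.
move=> [aC aw] mab; have /and3P[h1 h2 h3] := multi_type rf xv aC mab.
split; first by move: aC; rewrite !inE => /connect_trans; apply; apply: connect1.
have nbw : b != w by apply: contraNneq h3 => ->.
by case: (rainbow_free_star rf h1 h2 aw nbw).
Qed.

(** A three-coloured pair at [x] would be the whole component, and without any pair of several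
    colours at [x] the component is [[set x]]; both are too small. *)
Lemma component_type (V : finType) (g1 g2 g3 : rel V) x :
  rainbow_free g1 g2 g3 -> 2 < #|component g1 g2 g3 x| ->
  exists v, [\/ exactly2 g1 g2 g3 x v, exactly2 g2 g3 g1 x v
              | exactly2 g3 g1 g2 x v].
Proof.
move=> rf big.
case: (pickP (multi g1 g2 g3 x)) => [v xv|none].
  case: (multi_cases xv) => h; [exists v; by constructor 1
    | exists v; by constructor 2 | exists v; by constructor 3 |].
  have h' : all3 g1 g2 g3 v x.
    by move: h; rewrite /all3 (rf_sym1 rf) (rf_sym2 rf) (rf_sym3 rf).
  have: component g1 g2 g3 x \subset [set x; v].
    apply/subsetP => y; rewrite !inE => xy.
    apply: (connect_invariant (P := fun a => (a == x) || (a == v)) _ _ xy).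
      by rewrite eqxx.
    move=> a b /orP[]/eqP->; first by move/(multi_all3 rf h)->; rewrite eqxx orbT.
    by move/(multi_all3 rf h')->; rewrite eqxx.
  move/subset_leq_card; rewrite cards2; move: big; case: (x != v) => /=; lia.
have: component g1 g2 g3 x \subset [set x].
  apply/subsetP => y; rewrite !inE => xy.
  apply: (connect_invariant (P := fun a => a == x) _ _ xy) => // a b /eqP-> /=.
  by rewrite none.
move/subset_leq_card; rewrite cards1; move: big; lia.
Qed.

Lemma component_rot (V : finType) (g1 g2 g3 : rel V) x :
  component g2 g3 g1 x = component g1 g2 g3 x.
Proof. by apply/setP => y; rewrite !inE; apply: eq_connect => a b; rewrite multi_rot. Qed.

(** * Counting ordered pairs by colour set *)

(* Ordered pairs: [pairs G setT setT] is twice the number of edges of [G]. *)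
Definition pairs (V : finType) (g : rel V) (A B : {set V}) : nat :=
  \sum_(u in A) \sum_(v in B) g u v.

Lemma pairsC (V : finType) (g : rel V) (A B : {set V}) :
  symmetric g -> pairs g A B = pairs g B A.
Proof.
move=> sg; rewrite /pairs exchange_big /=.
by apply: eq_bigr => u _; apply: eq_bigr => v _; rewrite sg.
Qed.

Lemma sum_setC (V : finType) (F : V -> nat) (A : {set V}) :
  \sum_(u in [set: V]) F u = \sum_(u in A) F u + \sum_(u in ~: A) F u.
Proof.
rewrite (bigID (mem A)) /=; congr (_ + _); apply: eq_bigl => u; by rewrite !inE.
Qed.

Lemma pairs_split (V : finType) (g : rel V) (A : {set V}) : symmetric g ->
  pairs g setT setT = pairs g A A + 2 * pairs g A (~: A) + pairs g (~: A) (~: A).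
Proof.
move=> sg.
have row B : pairs g B setT = pairs g B A + pairs g B (~: A).
  rewrite /pairs -big_split /=; apply: eq_bigr => u _; exact: sum_setC.
have -> : pairs g setT setT = pairs g A setT + pairs g (~: A) setT.
  by rewrite /pairs (sum_setC _ A).
rewrite !row (pairsC (~: A) A sg); lia.
Qed.

Lemma pairs_neq (V : finType) (A : {set V}) :
  pairs (fun u v => u != v) A A = #|A| * #|A|.-1.
Proof.
rewrite /pairs -sum_nat_const; apply: eq_bigr => u uA.
rewrite [in RHS](cardsD1 u) uA add1n /= -sum1_card big_mkcond [RHS]big_mkcond /=.
apply: eq_bigr => v _; rewrite !inE eq_sym.
by case: (v \in A); case: (v == u).
Qed.

Lemma leq_pairs (V : finType) (g h : rel V) (A B : {set V}) :
  (forall u v, u \in A -> v \in B -> g u v -> h u v) ->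
  pairs g A B <= pairs h A B.
Proof.
move=> gh; apply: leq_sum => u uA; apply: leq_sum => v vB.
by have := gh u v uA vB; case: (g u v) => // ->.
Qed.

Lemma pairs_irreflexive (V : finType) (g : rel V) (A : {set V}) :
  irreflexive g -> pairs g A A <= #|A| * #|A|.-1.
Proof.
move=> ig; rewrite -pairs_neq; apply: leq_pairs => u v _ _.
by apply: contraTneq => ->; rewrite ig.
Qed.

Definition only (V : finType) (g1 g2 g3 : rel V) : rel V :=
  fun u v => [&& g1 u v, ~~ g2 u v & ~~ g3 u v].

Definition single (V : finType) (g1 g2 g3 : rel V) : rel V :=
  fun u v => colours g1 g2 g3 u v == 1.

Lemma pairs_colour (V : finType) (g1 g2 g3 : rel V) (A B : {set V}) :
  pairs g1 A B = pairs (exactly2 g1 g2 g3) A B + pairs (exactly2 g3 g1 g2) A B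
    + pairs (all3 g1 g2 g3) A B + pairs (only g1 g2 g3) A B.
Proof.
rewrite /pairs -!big_split; apply: eq_bigr => u _.
rewrite -!big_split; apply: eq_bigr => v _.
by rewrite /exactly2 /all3 /only; case: (g1 u v) (g2 u v) (g3 u v) => [] [] [].
Qed.

Lemma pairs_single (V : finType) (g1 g2 g3 : rel V) (A B : {set V}) :
  pairs (single g1 g2 g3) A B = pairs (only g1 g2 g3) A B
    + pairs (only g2 g3 g1) A B + pairs (only g3 g1 g2) A B.
Proof.
rewrite /pairs -!big_split; apply: eq_bigr => u _.
rewrite -!big_split; apply: eq_bigr => v _.
by rewrite /single /colours /only; case: (g1 u v) (g2 u v) (g3 u v) => [] [] [].
Qed.

Lemma pairs_total (V : finType) (g1 g2 g3 : rel V) (A : {set V}) :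
  rainbow_free g1 g2 g3 ->
  #|A| * #|A|.-1 = pairs (exactly2 g1 g2 g3) A A + pairs (exactly2 g2 g3 g1) A A
    + pairs (exactly2 g3 g1 g2) A A + pairs (all3 g1 g2 g3) A A
    + pairs (single g1 g2 g3) A A.
Proof.
move=> rf; rewrite -pairs_neq /pairs -!big_split; apply: eq_bigr => u _.
rewrite -!big_split; apply: eq_bigr => v _.
rewrite /single /colours /exactly2 /all3; have [<-|nuv] := eqVneq u v.
  by rewrite (rf_irr1 rf) (rf_irr2 rf) (rf_irr3 rf).
by have := rf_cover rf nuv; case: (g1 u v) (g2 u v) (g3 u v) => [] [] [].
Qed.

Lemma not_multi_single (V : finType) (g1 g2 g3 : rel V) u v :
  rainbow_free g1 g2 g3 -> u != v -> single g1 g2 g3 u v = ~~ multi g1 g2 g3 u v.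
Proof.
move=> rf nuv; rewrite /single /multi /colours.
by have := rf_cover rf nuv; case: (g1 u v) (g2 u v) (g3 u v) => [] [] [].
Qed.

Lemma all3_multi (V : finType) (g1 g2 g3 : rel V) u v :
  all3 g1 g2 g3 u v -> multi g1 g2 g3 u v.
Proof. by rewrite /multi /colours => /and3P[-> -> ->]. Qed.

Lemma exactly2_multi (V : finType) (g1 g2 g3 : rel V) u v :
  exactly2 g1 g2 g3 u v -> multi g1 g2 g3 u v.
Proof. by rewrite /multi /colours => /and3P[-> -> /negbTE->]. Qed.

(** * Single-coloured pairs against those with several colours *)

Lemma sum_bool_le (V : finType) (f : pred V) (A B : {set V}) :
  (forall v, v \in A -> f v -> v \in B) -> \sum_(v in A) f v <= #|B|.
Proof.
move=> fB; rewrite -sum1_card [X in X <= _]big_mkcond [X in _ <= X]big_mkcond /=.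
apply: leq_sum => v _; have := fB v; case: (v \in A) => //.
by case: (f v) => // ->.
Qed.

Lemma sum_bool_ge (V : finType) (f : pred V) (A B : {set V}) :
  (forall v, v \in B -> (v \in A) && f v) -> #|B| <= \sum_(v in A) f v.
Proof.
move=> fB; rewrite -sum1_card [X in X <= _]big_mkcond [X in _ <= X]big_mkcond /=.
apply: leq_sum => v _; have := fB v; case: (v \in B) => // /(_ isT).
by case/andP=> -> ->.
Qed.

Lemma sum_all3_le1 (V : finType) (g1 g2 g3 : rel V) u (A : {set V}) :
  rainbow_free g1 g2 g3 -> \sum_(v in A) all3 g1 g2 g3 u v <= 1.
Proof.
move=> rf; case: (pickP (all3 g1 g2 g3 u)) => [v uv|none].
  rewrite -(cards1 v); apply: sum_bool_le => w _ /all3_multi.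
  by move/(multi_all3 rf uv)->; rewrite inE.
by rewrite big1 // => w _; rewrite none.
Qed.

Lemma sum_single_all3 (V : finType) (g1 g2 g3 : rel V) u v (R : {set V}) :
  rainbow_free g1 g2 g3 -> all3 g1 g2 g3 u v ->
  #|R| - 2 <= \sum_(w in R) single g1 g2 g3 u w.
Proof.
move=> rf uv; apply: (@leq_trans #|R :\: [set u; v]|).
  have := cardsID [set u; v] R.
  have := subset_leq_card (subsetIr R [set u; v]); rewrite cards2.
  case: (u != v); lia.
apply: sum_bool_ge => w; rewrite !inE negb_or => /andP[/andP[wu wv] ->] /=.
rewrite not_multi_single ?(eq_sym u) //.
by apply: contra wv => /(multi_all3 rf uv)->.
Qed.

(** Vertex by vertex: at most one three-coloured pair, and if there is one, all other pairs at that
    vertex within [R], at least two, are single. *)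
Lemma all3_le_single (V : finType) (g1 g2 g3 : rel V) (R : {set V}) :
  rainbow_free g1 g2 g3 -> 4 <= #|R| ->
  2 * pairs (all3 g1 g2 g3) R R <= pairs (single g1 g2 g3) R R.
Proof.
move=> rf R4; rewrite /pairs big_distrr /=; apply: leq_sum => u uR.
case: (pickP (all3 g1 g2 g3 u)) => [v uv|none].
  have := sum_single_all3 R rf uv; have := sum_all3_le1 u R rf; lia.
by rewrite big1 // => w _; rewrite none.
Qed.

Definition vertices2 (V : finType) (g1 g2 g3 : rel V) (R : {set V}) : {set V} :=
  [set u in R | [exists v in R, exactly2 g1 g2 g3 u v]].

Lemma exactly2_sym (V : finType) (g1 g2 g3 : rel V) :
  rainbow_free g1 g2 g3 -> symmetric (exactly2 g1 g2 g3).
Proof.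
by case=> s1 s2 s3 *; rewrite /exactly2 => u v; rewrite s1 s2 s3.
Qed.

Lemma exactly2_clash (V : finType) (g1 g2 g3 : rel V) u v w :
  rainbow_free g1 g2 g3 -> exactly2 g1 g2 g3 u v -> exactly2 g2 g3 g1 u w -> False.
Proof.
move=> rf uv uw; have: multi g1 g2 g3 u w by rewrite -multi_rot exactly2_multi.
move/(multi_exactly2 rf uv)/and3P => [h1 _ _].
by case/and3P: uw => _ _; rewrite h1.
Qed.

(* A vertex on a {1,2}-edge and a vertex on a {2,3}-edge are joined by a
   single-coloured edge. *)
Lemma exactly2_le_single (V : finType) (g1 g2 g3 : rel V) (R : {set V}) :
  rainbow_free g1 g2 g3 -> 4 <= #|R| ->
  #|vertices2 g1 g2 g3 R| <= #|vertices2 g2 g3 g1 R| ->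
  pairs (exactly2 g1 g2 g3) R R + pairs (all3 g1 g2 g3) R R
    <= pairs (single g1 g2 g3) R R.
Proof.
move=> rf R4 PQ; have rf' := rainbow_free_rot rf.
rewrite /pairs -big_split /=; apply: leq_sum => u uR.
case: (pickP (all3 g1 g2 g3 u)) => [v uv|none].
  rewrite big1 => [|w _]; last first.
    apply/eqP; rewrite eqb0; apply/negP => uw.
    have /= wv := multi_all3 rf uv (exactly2_multi uw).
    by move: uw uv; rewrite wv /exactly2 /all3; case: (g3 u v); rewrite !andbF.
  have := sum_single_all3 R rf uv; have := sum_all3_le1 u R rf; lia.
rewrite [X in _ + X]big1 ?addn0; last by move=> w _; rewrite none.
case: (pickP (fun v => (v \in R) && exactly2 g1 g2 g3 u v)) => [v /andP[vR uv]|no2];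
  last first.
  by rewrite big1 // => w wR; have := no2 w; rewrite wR /= => ->.
(* The {1,2}-neighbours of [u] in [R] lie in [vertices2 g1 g2 g3 R], which is no larger than
   [vertices2 g2 g3 g1 R]; each vertex of the latter sends a single-coloured pair to [u]. *)
apply: (@leq_trans #|vertices2 g1 g2 g3 R|).
  apply: sum_bool_le => w wR uw; rewrite inE wR; apply/existsP; exists u.
  by rewrite uR exactly2_sym.
apply: (leq_trans PQ); apply: sum_bool_ge => w.
rewrite inE => /andP[wR /existsP[z /andP[zR wz]]]; rewrite wR /=.
rewrite not_multi_single //; last first.
  by apply/eqP => e; move: wz; rewrite -e => /(exactly2_clash rf uv).
apply/negP => uw; have uw2 := multi_exactly2 rf uv uw.
by apply: (exactly2_clash (v := u) rf _ wz); rewrite exactly2_sym.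
Qed.

(** * Recolouring around a big component *)

Lemma shift_factor x y z s : z <= x -> (x + s) * y * z <= x * y * (z + s).
Proof.
move=> zx; have : s * z * y <= s * x * y by rewrite leq_mul2r leq_mul2l zx !orbT.
by move=> h; rewrite mulnDr mulnDl mulnDl leq_add2l; lia.
Qed.

(* Moving [p] and [q] from the first two factors to the third one can only
   increase the product as long as the third factor stays the smallest. *)
Lemma shift_factors x y z p q :
  z + p <= x -> z + p + q <= y ->
  (x + p) * (y + q) * z <= x * y * (z + p + q).
Proof.
move=> zx zy; apply: (leq_trans (@shift_factor x (y + q) z p _)); first by lia.
have := @shift_factor y x (z + p) q; rewrite (mulnC x (y + q)) (mulnC x y).
by apply; lia.
Qed.

(* In the application [a] and [b] are what remains of colours 1 and 2 outside the
   big component once colour 3 is complete there, [S] counts the pairs with one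
   colour and [T] those with three. *)
Lemma product_rebalance K C S T a b :
  a + b + S = C + T -> b <= S -> a <= C -> 2 * T <= S -> 2 * C <= K ->
  (K + a) * (K + b) <= K * (K + C).
Proof.
move=> e bS aC TS CK.
(* Expanding the left side, the linear term [K * (a + b)] falls short of [K * C] by [K * (S - T)].
   This pays for [a * b], because [2 * T <= S] gives [S <= 2 * (S - T)]. *)
have h1 : a * b <= C * S by apply: leq_mul.
have h2 : C * S <= K * (S - T).
  apply: (@leq_trans (C * (2 * (S - T)))); first by rewrite leq_mul2l; lia.
  by rewrite mulnA leq_mul2r (mulnC C) CK orbT.
have h3 : K * (a + b) + K * (S - T) = K * C.
  by rewrite -mulnDr; congr (_ * _); lia.
nia.
Qed.

(** Here [R] is the complement of the big component, [K] counts the pairs inside the component and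
    [D] the crossing pairs, already recoloured with 3. *)
Lemma outside_bound (V : finType) (g1 g2 g3 : rel V) (R : {set V}) K D :
  rainbow_free g1 g2 g3 -> 4 <= #|R| ->
  2 * (#|R| * #|R|.-1) <= K -> D + #|R| * #|R|.-1 <= K ->
  (K + pairs g1 R R) * (K + pairs g2 R R) * (D + pairs g3 R R)
    <= K * (K + #|R| * #|R|.-1) * (D + #|R| * #|R|.-1).
Proof.
move=> rf R4 CK DK.
(* Exchanging colours 1 and 2 exchanges the two vertex sets. The order chosen provides the bound
   [b <= S] of [product_rebalance]. *)
wlog le : g1 g2 g3 rf / #|vertices2 g2 g3 g1 R| <= #|vertices2 g3 g1 g2 R|.
  move=> IH; have /orP[|le] := leq_total #|vertices2 g2 g3 g1 R| #|vertices2 g3 g1 g2 R|.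
    exact: IH.
  rewrite (mulnC (K + pairs g1 R R)); apply: IH; first exact: rainbow_free_swap.
  have swp h1 h2 h3 : vertices2 h2 h1 h3 R = vertices2 h1 h2 h3 R.
    apply/setP => u; rewrite !inE; congr (_ && _); apply: eq_existsb => v.
    by congr (_ && _); rewrite /exactly2 andbCA.
  by rewrite swp (swp g2 g3).
have rf' := rainbow_free_rot rf.
have hS := exactly2_le_single rf' R4 le.
have hT := all3_le_single rf' R4.
have tot := pairs_total R rf'.
have e1 := pairs_colour g1 g2 g3 R R.
have e2 := pairs_colour g2 g3 g1 R R.
have e3 := pairs_colour g3 g1 g2 R R.
have eS := pairs_single g2 g3 g1 R R.
have rot h1 h2 h3 : pairs (all3 h2 h3 h1) R R = pairs (all3 h1 h2 h3) R R.
  rewrite /pairs; apply: eq_bigr => u _; apply: eq_bigr => v _.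
  by rewrite /all3 andbA andbC.
move: hS hT tot e1 e2 e3 eS.
rewrite (rot g2 g3 g1) (rot g1 g2 g3).
set C := #|R| * _ in CK DK *.
move: (pairs (exactly2 g1 g2 g3) R R) (pairs (exactly2 g2 g3 g1) R R)
  (pairs (exactly2 g3 g1 g2) R R) (pairs (only g1 g2 g3) R R)
  (pairs (only g2 g3 g1) R R) (pairs (only g3 g1 g2) R R)
  (pairs (all3 g1 g2 g3) R R) (pairs (single g2 g3 g1) R R)
  => m12 m23 m31 s1 s2 s3 T S hS hT tot e1 e2 e3 eS.
(* What moves to colour 3: the pairs with colour 1 only, those with colour 2 only, and colour 2 of
   the {1,2}-pairs. Afterwards colour 3 is complete on [R]. *)
have -> : K + pairs g1 R R = K + (m12 + m31 + T) + s1 by lia.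
have -> : K + pairs g2 R R = K + (m23 + T) + (m12 + s2) by lia.
apply: leq_trans (shift_factors _ _) _; [lia | lia |].
apply: leq_mul; last by lia.
by apply: (@product_rebalance K C S T); lia.
Qed.

(* The product of the three numbers of ordered pairs when [|X| = k]. *)
Definition extremal_count n k : nat :=
  let K := k * k.-1 in let C := (n - k) * (n - k).-1 in
  K * (K + C) * (2 * (k * (n - k)) + C).

(** Colours 1 and 2 are at most complete inside [A]. The crossing pairs move to colour 3 first, by
    [shift_factors]; the pairs outside [A] follow, by [outside_bound]. *)
Lemma big_component_bound (V : finType) (g1 g2 g3 : rel V) (A : {set V}) :
  rainbow_free g1 g2 g3 ->
  (forall u w, u \in A -> w \notin A -> colours g1 g2 g3 u w <= 1) ->
  {in A &, forall u w, ~~ g3 u w} ->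
  4 <= #|~: A| ->
  2 * (#|~: A| * #|~: A|.-1) <= #|A| * #|A|.-1 ->
  2 * (#|A| * #|~: A|) + #|~: A| * #|~: A|.-1 <= #|A| * #|A|.-1 ->
  pairs g1 setT setT * pairs g2 setT setT * pairs g3 setT setT
    <= extremal_count #|V| #|A|.
Proof.
move=> rf cr no3 r4 CK DK.
rewrite !(pairs_split A) ?(rf_sym1 rf) ?(rf_sym2 rf) ?(rf_sym3 rf) //;
  try by [exact: rf_sym1 rf|exact: rf_sym2 rf|exact: rf_sym3 rf].
have -> : pairs g3 A A = 0.
  by rewrite /pairs big1 // => u uA; rewrite big1 // => v vA; rewrite (negbTE (no3 u v uA vA)).
have crb : pairs g1 A (~: A) + pairs g2 A (~: A) + pairs g3 A (~: A) <= #|A| * #|~: A|.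
  rewrite -sum_nat_const /pairs -!big_split; apply: leq_sum => u uA /=.
  rewrite -sum1_card -!big_split; apply: leq_sum => v; rewrite inE => vA.
  exact: cr.
have i1 := pairs_irreflexive A (rf_irr1 rf).
have i2 := pairs_irreflexive A (rf_irr2 rf).
have c3 := pairs_irreflexive (~: A) (rf_irr3 rf).
have out := outside_bound (K := #|A| * #|A|.-1) (D := 2 * (#|A| * #|~: A|)) rf r4 CK DK.
have eR : #|V| - #|A| = #|~: A| by rewrite -(cardsC A); lia.
rewrite /extremal_count eR.
apply: leq_trans out.
set K := #|A| * _ in i1 i2 DK *.
move: crb; set D := #|A| * #|~: A| in DK *.
move: c3 DK; set C := #|~: A| * _ => c3 DK.
move: (pairs g1 A (~: A)) (pairs g2 A (~: A)) (pairs g3 A (~: A)) => b1 b2 b3 crb.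
have sh := @shift_factors (K + pairs g1 (~: A) (~: A)) (K + pairs g2 (~: A) (~: A))
  (2 * b3 + pairs g3 (~: A) (~: A)) (2 * b1) (2 * b2).
apply: leq_trans (leq_trans (sh _ _) _); [|lia|lia|].
  by rewrite !leq_mul //; lia.
by rewrite leq_mul //; lia.
Qed.

(** * Numerical bounds and the choice of the big component *)

Lemma AGM3 a b c : 27 * (a * b * c) <= (a + b + c) ^ 3.
Proof.
wlog ab : a b c / a <= b.
  move=> IH; have /orP[/IH//|/IH] := leq_total a b.
  by move=> /(_ c); rewrite (mulnC b) (addnC b).
wlog bc : a b c ab / b <= c.
  move=> IH; have /orP[/(IH _ _ _ ab)//|cb] := leq_total b c.
  rewrite mulnAC addnAC.
  have /orP[ac|ca] := leq_total a c; first exact: IH.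
  rewrite (mulnC a) (addnC a); exact: IH.
(* In terms of [a] and the gaps [x], [y], the difference of the two sides has nonnegative
   coefficients only. *)
rewrite -(subnKC bc) -(subnKC ab).
move: (b - a) (c - b) => x y; rewrite !expnS expn0 muln1; nia.
Qed.

(** With [t = n %/ 5] the three factors are about [16 t^2], [17 t^2] and [9 t^2], and
    [16 * 17 * 9 / 25^3] exceeds [512 / 3375 = (8 / 15)^3], the AM-GM bound to beat. The slack
    absorbs the rounding once [5000 <= n]. *)
Lemma extremal_count_lower n : 5000 <= n ->
  512 * (n * n * (n * n) * (n * n)) <= 3375 * extremal_count n (4 * (n %/ 5)).
Proof.
move=> n5.
have [t [t1 tn nt ->]] : exists t, [/\ 1000 <= t, 5 * t <= n, n <= 5 * t + 4 & n %/ 5 = t].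
  exists (n %/ 5); split=> //; lia.
have hK : 1599 * (t * t) <= 100 * (4 * t * (4 * t).-1) by nia.
have hC : 99 * (t * t) <= 100 * ((n - 4 * t) * (n - 4 * t).-1).
  have : t * t.-1 <= (n - 4 * t) * (n - 4 * t).-1 by apply: leq_mul; lia.
  nia.
have hD : 8 * (t * t) <= 2 * (4 * t * (n - 4 * t)).
  have : t * t <= t * (n - 4 * t) by apply: leq_mul; lia.
  lia.
have hn : 100 * (n * n) <= 2511 * (t * t).
  have : (100 * n) * (100 * n) <= (501 * t) * (501 * t) by apply: leq_mul; lia.
  lia.
rewrite /extremal_count.
move: (4 * t * (4 * t).-1) ((n - 4 * t) * (n - 4 * t).-1)
  (2 * (4 * t * (n - 4 * t))) (n * n) (t * t) hK hC hD hn
  => K C D N s hK hC hD hn.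
have hN : (100 * N) * (100 * N) * (100 * N)
    <= (2511 * s) * (2511 * s) * (2511 * s) by apply: leq_mul => //; apply: leq_mul.
have hP : (1599 * s) * (1698 * s) * (899 * s)
    <= (100 * K) * (100 * (K + C)) * (100 * (D + C)).
  by apply: leq_mul; [apply: leq_mul|]; lia.
move: (K + C) (D + C) hP => E F hP.
lia.
Qed.

(** A pair has one colour, one more if it is in [multi] and one more if in [all3]. The last kind is
    a matching, and its at most [#|V|] ordered pairs fit into the missing diagonal. *)
Lemma sum_colours_le (V : finType) (g1 g2 g3 : rel V) : rainbow_free g1 g2 g3 ->
  pairs g1 setT setT + pairs g2 setT setT + pairs g3 setT setT
    <= #|V| * #|V| + pairs (multi g1 g2 g3) setT setT.
Proof.
move=> rf.
have T : pairs (all3 g1 g2 g3) setT setT <= #|V|.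
  apply: (@leq_trans (\sum_(u in [set: V]) 1)); last by rewrite sum1_card cardsT.
  by apply: leq_sum => u _; apply: sum_all3_le1.
have : pairs g1 setT setT + pairs g2 setT setT + pairs g3 setT setT
  <= pairs (fun u v : V => u != v) setT setT + pairs (multi g1 g2 g3) setT setT
     + pairs (all3 g1 g2 g3) setT setT.
  rewrite /pairs -!big_split /=; apply: leq_sum => u _ /=.
  rewrite -!big_split /=; apply: leq_sum => v _.
  rewrite /multi /all3 /colours; have [<-|_] := eqVneq u v.
    by rewrite (rf_irr1 rf) (rf_irr2 rf) (rf_irr3 rf).
  by case: (g1 u v) (g2 u v) (g3 u v) => [] [] [].
rewrite pairs_neq cardsT; move: T; case: #|V| => [|n] /=; nia.
Qed.

Lemma pairs_le_card (V : finType) (g : rel V) (A B : {set V}) :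
  pairs g A B <= #|A| * #|B|.
Proof.
rewrite /pairs -sum_nat_const; apply: leq_sum => u _.
by rewrite -sum1_card; apply: leq_sum => v _; case: (g u v).
Qed.

Lemma multi_component (V : finType) (g1 g2 g3 : rel V) x :
  rainbow_free g1 g2 g3 ->
  pairs (multi g1 g2 g3) setT setT
    <= #|component g1 g2 g3 x| * #|component g1 g2 g3 x|
       + #|~: component g1 g2 g3 x| * #|~: component g1 g2 g3 x|.
Proof.
move=> rf; set A := component g1 g2 g3 x; rewrite (pairs_split A); last exact: multi_sym.
have -> : pairs (multi g1 g2 g3) A (~: A) = 0.
  rewrite /pairs big1 // => u uA; rewrite big1 // => v; rewrite inE => vA.
  by rewrite /multi ltnNge (component_single uA vA).
by rewrite muln0 addn0 leq_add // pairs_le_card.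
Qed.

Lemma multi_small_components (V : finType) (g1 g2 g3 : rel V) c :
  (forall x, #|component g1 g2 g3 x| <= c) ->
  pairs (multi g1 g2 g3) setT setT <= #|V| * c.
Proof.
move=> small; rewrite -cardsT -sum_nat_const; apply: leq_sum => u _.
apply: leq_trans (small u); apply: sum_bool_le => v _ uv.
by rewrite inE connect1.
Qed.

(** A component of between [2/7] and [5/7] of the vertices splits the multi-coloured pairs, leaving
    at most [(25 + 4) / 49 < 3/5]. Otherwise all components are below [2/7], which bounds every
    degree. *)
Lemma multi_balanced (V : finType) (g1 g2 g3 : rel V) :
  rainbow_free g1 g2 g3 -> (forall x, 7 * #|component g1 g2 g3 x| <= 5 * #|V|) ->
  5 * pairs (multi g1 g2 g3) setT setT <= 3 * (#|V| * #|V|).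
Proof.
move=> rf le5.
case: (pickP (fun x => 2 * #|V| <= 7 * #|component g1 g2 g3 x|)) => [x x2|no].
  have := multi_component x rf; have := cardsC (component g1 g2 g3 x); have := le5 x.
  move: x2 => /=; set c := #|component _ _ _ _|; set d := #|~: _|; nia.
have := @multi_small_components _ g1 g2 g3 ((2 * #|V|) %/ 7).
have h x : #|component g1 g2 g3 x| <= (2 * #|V|) %/ 7.
  by have := no x => /negbT; rewrite -ltnNge; lia.
move/(_ h); move: (pairs _ _ _) => M hM.
have : 7 * (2 * #|V| %/ 7) <= 2 * #|V| by lia.
move: hM; move: (_ %/ 7) => q; nia.
Qed.

Lemma component_bound12 (V : finType) (g1 g2 g3 : rel V) x v :
  5000 <= #|V| -> rainbow_free g1 g2 g3 -> exactly2 g1 g2 g3 x v ->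
  5 * #|V| < 7 * #|component g1 g2 g3 x| ->
  exists2 k, k <= #|V| &
  pairs g1 setT setT * pairs g2 setT setT * pairs g3 setT setT
    <= extremal_count #|V| k.
Proof.
move=> n5 rf xv; set A := component _ _ _ _ => big.
have no3 := component_third rf xv.
have eA := cardsC A.
have [r4|r4] := leqP 4 #|~: A|.
  exists #|A|; first by lia.
  apply: big_component_bound r4 _ _ => //.
  - by move=> u w uA wA; apply: component_single uA wA.
  - move: big eA; move: #|V| #|A| #|~: A| n5 => n [|k] r n5 big eA /=; first by lia.
    case: r eA => [|r] eA /=; nia.
  - move: big eA; move: #|V| #|A| #|~: A| n5 => n [|k] r n5 big eA /=; first by lia.
    case: r eA => [|r] eA /=; nia.
(* At most three vertices lie outside [A], and every pair of colour 3 meets one of them; the product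
   is at most [7 n^5]. *)
exists (4 * (#|V| %/ 5)); first by lia.
have h1 := pairs_le_card g1 setT setT; have h2 := pairs_le_card g2 setT setT.
have h3 : pairs g3 setT setT <= 7 * #|V|.
  rewrite (pairs_split A); last exact: rf_sym3 rf.
  have -> : pairs g3 A A = 0.
    rewrite /pairs big1 // => u uA; rewrite big1 // => w wA.
    by rewrite (negbTE (no3 u w uA wA)).
  have := pairs_le_card g3 A (~: A); have := pairs_le_card g3 (~: A) (~: A).
  nia.
have low := extremal_count_lower n5.
rewrite !cardsT in h1 h2.
have := leq_mul (leq_mul h1 h2) h3.
set P := _ * _ * pairs g3 _ _ => hP.
rewrite -(@leq_pmul2l 3375) //; apply: leq_trans low.
have : 3375 * P <= 3375 * (#|V| * #|V| * (#|V| * #|V|) * (7 * #|V|)) by rewrite leq_mul2l hP.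
move/leq_trans; apply.
rewrite (mulnC 512) (mulnC 3375) -!mulnA !leq_mul2l.
do !(apply/orP; right).
nia.
Qed.

Lemma pairs_product_bound (V : finType) (g1 g2 g3 : rel V) :
  5000 <= #|V| -> rainbow_free g1 g2 g3 ->
  exists2 k, k <= #|V| &
  pairs g1 setT setT * pairs g2 setT setT * pairs g3 setT setT
    <= extremal_count #|V| k.
Proof.
move=> n5 rf.
case: (pickP (fun x => 5 * #|V| < 7 * #|component g1 g2 g3 x|)) => [x big|no].
  have [|v] := component_type (x := x) rf; first by lia.
  case=> h.
  - exact: component_bound12 rf h big.
  - have rf' := rainbow_free_rot rf.
    rewrite -component_rot in big.
    have [k kn le] := component_bound12 n5 rf' h big; exists k => //.
    by apply: leq_trans le; rewrite -mulnA mulnC.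
  - have rf' := rainbow_free_rot (rainbow_free_rot rf).
    rewrite -component_rot -component_rot in big.
    have [k kn le] := component_bound12 n5 rf' h big; exists k => //.
    by apply: leq_trans le; rewrite mulnC mulnA.
exists (4 * (#|V| %/ 5)); first by lia.
have small x : 7 * #|component g1 g2 g3 x| <= 5 * #|V|.
  by have := no x => /negbT; rewrite -leqNgt.
have M := multi_balanced rf small.
have S := sum_colours_le rf.
have low := extremal_count_lower n5.
have agm := AGM3 (pairs g1 setT setT) (pairs g2 setT setT) (pairs g3 setT setT).
move: agm; set P := _ * pairs g3 _ _; set s := _ + pairs g3 _ _ in S * => agm.
(* The sum is at most [(1 + 3/5) n^2], so AM-GM bounds the product by [(8 / 15)^3 n^6]. *)
have s5 : 5 * s <= 8 * (#|V| * #|V|) by lia.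
have s3 : (5 * s) ^ 3 <= (8 * (#|V| * #|V|)) ^ 3 by rewrite leq_exp2r.
rewrite -(@leq_pmul2l 3375) //; apply: leq_trans low.
move: agm s3; rewrite !expnS expn0 !muln1; move: (#|V| * #|V|) => N agm s3.
lia.
Qed.

(** * From edge sets of graphs to relations *)

Lemma eq_set2 (V : finType) (u v x y : V) : [set u; v] = [set x; y] ->
  (u = x /\ v = y) \/ (u = y /\ v = x).
Proof.
move=> e.
have : u \in [set x; y] by rewrite -e set21.
have : v \in [set x; y] by rewrite -e set22.
have : x \in [set u; v] by rewrite e set21.
have : y \in [set u; v] by rewrite e set22.
rewrite !inE => /pred2P hy /pred2P hx /pred2P hv /pred2P hu.
by case: hu hv hx hy => ? [] ? [] ? [] ?; subst; auto.
Qed.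

Lemma mem_edges (V : finType) (G : sgraph V) u v :
  ([set u; v] \in edges G) = adj G u v.
Proof.
apply/imset2P/idP => [[x y _ ] /=|uv]; last by exists u v; rewrite ?inE.
rewrite inE => xy /eq_set2[[-> ->]|[-> ->]] //.
by rewrite adj_sym.
Qed.

Lemma double_card_edges (V : finType) (G : sgraph V) :
  2 * #|edges G| = pairs G setT setT.
Proof.
rewrite /pairs pair_big /= mulnC -sum_nat_const.
rewrite (eq_bigr (fun p : V * V => if adj G p.1 p.2 then 1 else 0)); last first.
  by move=> p _; case: (adj G _ _).
rewrite -big_mkcondr /=.
(* The ordered pairs are grouped by their edge; each fibre is [[set (x, y); (y, x)]]. *)
rewrite (partition_big (fun p : V * V => [set p.1; p.2]) (mem (edges G))) /=; last first.
  by move=> p /andP[_ ?]; rewrite mem_edges.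
apply: eq_bigr => e /imset2P[x y _]; rewrite inE /= => xy ->.
have nxy : x != y by apply: contraTneq xy => ->; rewrite adj_irr.
have -> : 2 = #|[set (x, y); (y, x)]|.
  by rewrite cards2 xpair_eqE negb_and nxy.
rewrite -sum1_card; apply: eq_bigl => -[u v]; rewrite !inE /= !xpair_eqE.
apply/idP/idP => [/orP[]/andP[/eqP-> /eqP->]|/andP[_ /eqP]].
- by rewrite xy eqxx.
- by rewrite adj_sym xy setUC eqxx.
- by case/eq_set2=> -[-> ->]; rewrite !eqxx ?orbT.
Qed.

Lemma admissibleP (V : finType) (G1 G2 G3 : sgraph V) :
  admissible G1 G2 G3 <-> rainbow_free G1 G2 G3.
Proof.
split=> [[nr cov]|rf].
  split; try exact: adj_sym; try exact: adj_irr.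
    by move=> u v /cov; rewrite !mem_edges => -[]->; rewrite ?orbT.
  move=> u v w uv vw uw; apply: (nr u v w); split.
  - by apply: contraTneq uv => ->; rewrite adj_irr.
  - by apply: contraTneq vw => ->; rewrite adj_irr.
  - by apply: contraTneq uw => ->; rewrite adj_irr.
  exists 1%g => -[[|[|[|//]]] i3]; by rewrite perm1 !(tnth_nth set0) !(tnth_nth G1) /= mem_edges.
split; last first.
  by move=> u v /(rf_cover rf); rewrite !mem_edges => /or3P[] ->; constructor.
move=> u v w [_ _ _ [s sP]].
have H0 := sP (inord 0); have H1 := sP (inord 1); have H2 := sP (inord 2).
have ne i j : i < 3 -> j < 3 -> i != j -> s (inord i) != s (inord j).
  by move=> i3 j3 ij; rewrite (inj_eq perm_inj) -val_eqE /= !inordK.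
have n01 := ne 0 1 isT isT isT; have n02 := ne 0 2 isT isT isT.
have n12 := ne 1 2 isT isT isT.
move: H0 H1 H2 n01 n02 n12.
rewrite !(tnth_nth set0) !(tnth_nth G1) !inordK //= -!val_eqE /=.
have fr := rf_free rf.
have s1 := @adj_sym _ G1; have s2 := @adj_sym _ G2; have s3 := @adj_sym _ G3.
(* Injectivity of [s] leaves six of the 27 cases, each an instance of [rf_free] with the vertices
   permuted. *)
case: (s (inord 0)) (s (inord 1)) (s (inord 2)) => [[|[|[|//]]] ?] [[|[|[|//]]] ?] [[|[|[|//]]] ?] //=; 
  rewrite !mem_edges => h0 h1 h2 _ _ _.
- exact: (fr u v w).
- by apply: (fr v u w); rewrite ?(s1 v).
- by apply: (fr w v u); rewrite ?(s1 w) ?(s2 v) ?(s3 w).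
- by apply: (fr w u v); rewrite ?(s1 w) ?(s3 w).
- by apply: (fr v w u); rewrite ?(s2 w) ?(s3 v).
- by apply: (fr u w v); rewrite ?(s2 w).
Qed.

(** * The extremal construction *)

Definition clique_rel (V : finType) (X : {set V}) : rel V :=
  fun u v => [&& u != v, u \in X & v \in X].

Definition two_cliques_rel (V : finType) (X : {set V}) : rel V :=
  fun u v => (u != v) && ((u \in X) == (v \in X)).

(** With [Y = ~: X], the clique on [Y] and the crossing pairs together are the pairs not inside
    [X]. *)
Definition non_clique_rel (V : finType) (X : {set V}) : rel V :=
  fun u v => (u != v) && ~~ ((u \in X) && (v \in X)).

Lemma clique_rel_sym (V : finType) (X : {set V}) : symmetric (clique_rel X).
Proof. by move=> u v; rewrite /clique_rel eq_sym (andbC (u \in X)). Qed.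

Lemma clique_rel_irr (V : finType) (X : {set V}) : irreflexive (clique_rel X).
Proof. by move=> u; rewrite /clique_rel eqxx. Qed.

Lemma two_cliques_rel_sym (V : finType) (X : {set V}) :
  symmetric (two_cliques_rel X).
Proof. by move=> u v; rewrite /two_cliques_rel eq_sym (eq_sym (u \in X)). Qed.

Lemma two_cliques_rel_irr (V : finType) (X : {set V}) :
  irreflexive (two_cliques_rel X).
Proof. by move=> u; rewrite /two_cliques_rel eqxx. Qed.

Lemma non_clique_rel_sym (V : finType) (X : {set V}) :
  symmetric (non_clique_rel X).
Proof. by move=> u v; rewrite /non_clique_rel eq_sym (andbC (u \in X)). Qed.

Lemma non_clique_rel_irr (V : finType) (X : {set V}) :
  irreflexive (non_clique_rel X).
Proof. by move=> u; rewrite /non_clique_rel eqxx. Qed.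

Definition clique_graph (V : finType) (X : {set V}) : sgraph V :=
  SGraph (@clique_rel_sym V X) (@clique_rel_irr V X).

Definition two_cliques_graph (V : finType) (X : {set V}) : sgraph V :=
  SGraph (@two_cliques_rel_sym V X) (@two_cliques_rel_irr V X).

Definition non_clique_graph (V : finType) (X : {set V}) : sgraph V :=
  SGraph (@non_clique_rel_sym V X) (@non_clique_rel_irr V X).

(** An edge of colour 1 lies in [X] and an edge of colour 2 does not leave [X], so the third side
    would lie inside [X], where colour 3 is absent. *)
Lemma extremal_admissible (V : finType) (X : {set V}) :
  admissible (clique_graph X) (two_cliques_graph X) (non_clique_graph X).
Proof.
apply/admissibleP; split; try exact: adj_sym; try exact: adj_irr.
  move=> u v /= nuv; rewrite /clique_rel /two_cliques_rel /non_clique_rel nuv /=.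
  by case: (u \in X) (v \in X) => [] [].
move=> u v w /and3P[_ uX vX] /andP[_ /eqP vw].
by rewrite /= /non_clique_rel -vw uX vX andbF.
Qed.

Lemma edgesP (V : finType) (G : sgraph V) (e : {set V}) :
  reflect (exists u v, e = [set u; v] /\ adj G u v) (e \in edges G).
Proof.
apply: (iffP imset2P) => [[u v _]|[u [v [-> uv]]]].
  by rewrite inE => uv ->; exists u, v.
by exists u v; rewrite ?inE.
Qed.

Lemma complete_edgesP (V : finType) (X : {set V}) (e : {set V}) :
  reflect (exists u v, [/\ e = [set u; v], u != v, u \in X & v \in X])
          (e \in complete_edges X).
Proof.
rewrite inE; apply: (iffP andP) => [[eX /cards2P[u [v [nuv ee]]]]|].
  exists u, v; split=> //; apply: (subsetP eX); rewrite ee; [exact: set21|exact: set22].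
case=> u [v [-> nuv uX vX]]; rewrite cards2 nuv; split=> //.
by rewrite subUset !sub1set uX.
Qed.

Lemma extremal_formP (V : finType) (X : {set V}) :
  extremal_form X (~: X) (clique_graph X) (two_cliques_graph X) (non_clique_graph X).
Proof.
split; first by rewrite setUCr -setI_eq0 setICr eqxx.
- apply/setP => e; apply/edgesP/complete_edgesP => -[u [v]].
    by case=> -> /and3P[]; exists u, v.
  by case=> -> nuv uX vX; exists u, v; split=> //; apply/and3P.
- apply/setP => e; rewrite inE; apply/edgesP/orP => [[u [v [-> /andP[nuv /eqP uv]]]]|].
    case uX : (u \in X); [left|right]; apply/complete_edgesP; exists u, v.
      by rewrite -uv uX.
    by rewrite !inE -uv uX.
  case=> /complete_edgesP[u [v]]; rewrite ?inE => -[-> nuv uX vX]; exists u, v.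
    by split=> //; rewrite /= /two_cliques_rel nuv uX vX.
  by split=> //; rewrite /= /two_cliques_rel nuv (negbTE uX) (negbTE vX).
- apply/setP => e; rewrite inE; apply/edgesP/orP => [[u [v [-> /andP[nuv]]]]|].
    case uX : (u \in X) => /=; case vX : (v \in X) => //= _.
    + by right; apply/imset2P; exists u v; rewrite ?inE ?vX.
    + by right; apply/imset2P; exists v u; rewrite ?inE ?uX // setUC.
    + by left; apply/complete_edgesP; exists u, v; rewrite !inE uX vX.
  case.
    case/complete_edgesP=> u [v]; rewrite !inE => -[-> nuv uX vX]; exists u, v.
    by split=> //; rewrite /= /non_clique_rel nuv (negbTE uX).
  case/imset2P=> u v uX; rewrite inE => vX ->; exists u, v; split=> //.
  rewrite /= /non_clique_rel (negbTE vX) andbF andbT.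
  by apply: contraNneq vX => <-.
Qed.

Lemma eq_pairs (V : finType) (g h : rel V) (A B : {set V}) :
  {in A & B, g =2 h} -> pairs g A B = pairs h A B.
Proof.
by move=> gh; apply: eq_bigr => u uA; apply: eq_bigr => v vB; rewrite gh.
Qed.

Lemma pairs_xpred0 (V : finType) (A B : {set V}) :
  pairs (fun _ _ => false) A B = 0.
Proof. by rewrite /pairs big1 // => u _; rewrite big1. Qed.

Lemma pairs_xpredT (V : finType) (A B : {set V}) :
  pairs (fun _ _ => true) A B = #|A| * #|B|.
Proof.
by rewrite /pairs -sum_nat_const; apply: eq_bigr => u _; rewrite -sum1_card.
Qed.

(** The factor 8 arises from counting the edges of each of the three graphs twice. *)
Lemma extremal_edge_product (V : finType) (X : {set V}) :
  8 * edge_product (clique_graph X) (two_cliques_graph X) (non_clique_graph X)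
    = extremal_count #|V| #|X|.
Proof.
have e1 := double_card_edges (clique_graph X).
have e2 := double_card_edges (two_cliques_graph X).
have e3 := double_card_edges (non_clique_graph X).
have -> : 8 * edge_product (clique_graph X) (two_cliques_graph X) (non_clique_graph X)
  = 2 * #|edges (clique_graph X)| * (2 * #|edges (two_cliques_graph X)|)
      * (2 * #|edges (non_clique_graph X)|) by rewrite /edge_product; lia.
rewrite e1 e2 e3 !(pairs_split X); try exact: adj_sym.
have eR : #|V| - #|X| = #|~: X| by rewrite -(cardsC X); lia.
rewrite /extremal_count eR -!pairs_neq.
have nX u v : u \in X -> v \in ~: X -> u != v.
  by move=> uX; rewrite inE; apply: contraNneq => <-.
rewrite (eq_pairs (g := clique_graph X) (h := fun u v => u != v) (A := X) (B := X));
  last by move=> u v uX vX; rewrite /= /clique_rel uX vX /= andbT.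
rewrite (eq_pairs (g := clique_graph X) (h := fun _ _ => false) (A := X) (B := ~: X));
  last by move=> u v uX; rewrite inE /= /clique_rel => /negbTE->; rewrite !andbF.
rewrite (eq_pairs (g := clique_graph X) (h := fun _ _ => false) (A := ~: X) (B := ~: X));
  last by move=> u v _; rewrite inE /= /clique_rel => /negbTE->; rewrite !andbF.
rewrite (eq_pairs (g := two_cliques_graph X) (h := fun u v => u != v) (A := X) (B := X));
  last by move=> u v uX vX; rewrite /= /two_cliques_rel uX vX eqxx andbT.
rewrite (eq_pairs (g := two_cliques_graph X) (h := fun _ _ => false) (A := X) (B := ~: X));
  last by move=> u v uX; rewrite inE /= /two_cliques_rel uX => /negbTE->; rewrite !andbF.
rewrite (eq_pairs (g := two_cliques_graph X) (h := fun u v => u != v) (A := ~: X) (B := ~: X));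
  last by move=> u v; rewrite !inE /= /two_cliques_rel => /negbTE-> /negbTE->; rewrite andbT.
rewrite (eq_pairs (g := non_clique_graph X) (h := fun _ _ => false) (A := X) (B := X));
  last by move=> u v uX vX; rewrite /= /non_clique_rel uX vX andbF.
rewrite (eq_pairs (g := non_clique_graph X) (h := fun _ _ => true) (A := X) (B := ~: X));
  last first.
  move=> u v uX vX; rewrite /= /non_clique_rel (nX u v) //=.
  by move: vX; rewrite inE => /negbTE->; rewrite andbF.
rewrite (eq_pairs (g := non_clique_graph X) (h := fun u v => u != v) (A := ~: X) (B := ~: X));
  last by move=> u v; rewrite !inE /= /non_clique_rel => /negbTE-> _; rewrite andbT.
by rewrite !pairs_xpred0 pairs_xpredT muln0 !addn0 add0n.
Qed.

Lemma exists_subset_card (V : finType) k :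
  k <= #|V| -> exists X : {set V}, #|X| = k.
Proof.
move=> kV; exists [set x in take k (enum V)].
rewrite cardsE (card_uniqP _) ?take_uniq ?enum_uniq //.
by rewrite size_takel // -cardE.
Qed.

Theorem theorem3 :
  exists n0 : nat, forall (n : nat) (V : finType), n0 <= n -> #|V| = n ->
    exists G1 G2 G3 : sgraph V,
      [/\ admissible G1 G2 G3,
          exists X Y : {set V}, extremal_form X Y G1 G2 G3
        & forall H1 H2 H3 : sgraph V, admissible H1 H2 H3 ->
            edge_product H1 H2 H3 <= edge_product G1 G2 G3].
Proof.
exists 5000 => n V n5 Vn; rewrite -Vn in n5.
(* The optimal size of [X] is not computed; a best one among [0, ..., #|V|] dominates whatever size
   the upper bound yields. *)
pose k : 'I_#|V|.+1 := [arg max_(i > ord0) extremal_count #|V| i].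
have kmax j : j <= #|V| -> extremal_count #|V| j <= extremal_count #|V| k.
  move=> jV; rewrite /k; case: arg_maxnP => // i _ /(_ (inord j) isT).
  by rewrite /= inordK.
have [X Xk] : exists X : {set V}, #|X| = k.
  by apply: exists_subset_card; rewrite -ltnS.
exists (clique_graph X), (two_cliques_graph X), (non_clique_graph X); split.
- exact: extremal_admissible.
- by exists X, (~: X); apply: extremal_formP.
move=> H1 H2 H3 /admissibleP rf.
have [j jV le] := pairs_product_bound n5 rf.
rewrite -(@leq_pmul2l 8) // extremal_edge_product Xk.
apply: leq_trans (kmax j jV); apply: leq_trans le.
by rewrite -!double_card_edges /edge_product; lia.
Qed.
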